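(* Let $n\in\mathbb{N}$ and let $E_1,\ldots,E_n,F$ be Banach spaces. If $\mathcal{L}(E_1,\ldots,E_n)$ or $F^*$ has the approximation property, then the hyper-Borel transform $$\mathcal{B}_n\colon(\mathcal{HN}(E_1,\ldots,E_n;F),\|\cdot\|_{\mathcal{HN}})^*\longrightarrow\mathcal{L}(\mathcal{L}(E_1,\ldots,E_n);F^* ),\quad \mathcal{B}_n(\phi)(A)(y)=\phi(A\otimes y),$$ is an isometric isomorphism (onto), where the target space carries the usual operator norm.
   Context: Banach spaces are over $\mathbb{K}=\mathbb{R}$ or $\mathbb{C}$. $\mathcal{L}(E_1,\ldots,E_n;F)$ is the Banach space of continuous $n$-linear operators with the usual operator norm; $\mathcal{L}(E_1,\ldots,E_n)$ is the case $F=\mathbb{K}$. For $A\in\mathcal{L}(E_1,\ldots,E_n)$, $y\in F$, $(A\otimes y)(x_1,\ldots,x_n)=A(x_1,\ldots,x_n)y$. An operator $A\in\mathcal{L}(E_1,\ldots,E_n;F)$ is hyper-nuclear, $A\in\mathcal{HN}(E_1,\ldots,E_n;F)$, if there are $(\lambda_j)_{j=1}^\infty\in\ell_1$, a bounded sequence $(B_j)_{j=1}^\infty$ in $\mathcal{L}(E_1,\ldots,E_n)$ and a bounded sequence $(y_j)_{j=1}^\infty$ in $F$ such that $A(x_1,\ldots,x_n)=\sum_{j=1}^\infty\lambda_jB_j(x_1,\ldots,x_n)y_j$ for all $x_i\in E_i$, $i=1,\ldots,n$. The norm is $\|A\|_{\mathcal{HN}}=\inf\sum_{j=1}^\infty|\lambda_j|\cdot\|B_j\|\cdot\|y_j\|$,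 the infimum being taken over all such representations of $A$ (equivalently, $\inf\|(\lambda_j)_j\|_1\cdot\sup_j\|B_j\|\cdot\sup_j\|y_j\|$). *)

(* Defs.v *)
From HB Require Import structures.
From mathcomp Require Import all_boot all_order all_algebra.
From mathcomp Require Import complex.
From mathcomp Require Import mathcomp_extra boolp classical_sets functions.
From mathcomp Require Import reals interval_inference topology normedtype.
From mathcomp Require Import sequences.

Set Implicit Arguments.
Unset Strict Implicit.
Unset Printing Implicit Defensive.

Import Order.TTheory GRing.Theory Num.Theory.
Import numFieldNormedType.Exports.

Local Open Scope classical_set_scope.
Local Open Scope ring_scope.

(* The scalar field is R or R[i]; both cases are treated at once through the
   following two-valued parameter. *)
Variant scalar_kind := RealScalars | ComplexScalars.

Definition scalars (R : realType) (k : scalar_kind) : numFieldType :=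
  match k with RealScalars => R | ComplexScalars => R[i] end.

Section scalars.
Context {R : realType} {k : scalar_kind}.

Definition re_scalar : scalars R k -> R :=
  match k with RealScalars => id | ComplexScalars => @complex.Re R end.

Definition of_real : R -> scalars R k :=
  match k with RealScalars => id | ComplexScalars => fun x => (x%:C)%C end.

Lemma of_realD x y : of_real (x + y) = of_real x + of_real y.
Proof. by rewrite /of_real; case: k => //=; rewrite rmorphD. Qed.

Lemma of_realM x y : of_real (x * y) = of_real x * of_real y.
Proof. by rewrite /of_real; case: k => //=; rewrite rmorphM. Qed.

Lemma of_real0 : of_real 0 = 0.
Proof. by rewrite /of_real; case: k. Qed.

Lemma of_real1 : of_real 1 = 1.
Proof. by rewrite /of_real; case: k. Qed.

Lemma ler_of_real x y : (of_real x <= of_real y) = (x <= y).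
Proof. by rewrite /of_real; case: k => //=; rewrite lecR. Qed.

Lemma ltr_of_real x y : (of_real x < of_real y) = (x < y).
Proof. by rewrite /of_real; case: k => //=; rewrite ltcR. Qed.

Lemma of_realK : cancel of_real re_scalar.
Proof. by rewrite /of_real /re_scalar; case: k. Qed.

Lemma of_real_inj : injective of_real.
Proof. exact: can_inj of_realK. Qed.

Lemma re_scalarK (z : scalars R k) : 0 <= z -> of_real (re_scalar z) = z.
Proof.
rewrite /of_real /re_scalar; move: z; case: k => //= -[a b].
by rewrite lecE /= => /andP[/eqP-> _].
Qed.

Lemma of_real_real x : of_real x \is Num.real.
Proof. by rewrite realE -of_real0 !ler_of_real le_total. Qed.

Lemma of_real_norm x : 0 <= x -> `|of_real x| = of_real x.
Proof. by move=> x0; rewrite ger0_norm// -of_real0 ler_of_real. Qed.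

End scalars.
Arguments of_real {R} k x.

Section rnorm.
Context {R : realType} {k : scalar_kind}.
Local Notation K := (scalars R k).

(* In a normedModType K the library norm `|x| takes its values in K, hence in
   R[i] in the complex case. rnorm is the same norm seen as an element of R
   (see rnormE); it is what sups, infs and series of norms are taken of. *)
Definition rnorm (V : normedModType K) (x : V) : R := re_scalar `|x|.

Section theory.
Context {V : normedModType K}.
Implicit Types x y : V.

Lemma rnormE x : of_real k (rnorm x) = `|x|.
Proof. exact: re_scalarK. Qed.

Lemma rnorm_ge0 x : 0 <= rnorm x.
Proof. by rewrite -(@ler_of_real _ k) of_real0 rnormE. Qed.

Lemma rnorm0 : rnorm (0 : V) = 0.
Proof. by rewrite /rnorm normr0 -(@of_real0 _ k) of_realK. Qed.

Lemma rnorm_eq0 x : rnorm x = 0 -> x = 0.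
Proof. by move=> x0; apply/normr0_eq0; rewrite -rnormE x0 of_real0. Qed.

Lemma rnormD x y : rnorm (x + y) <= rnorm x + rnorm y.
Proof. by rewrite -(@ler_of_real _ k) of_realD !rnormE ler_normD. Qed.

Lemma rnormN x : rnorm (- x) = rnorm x.
Proof. by rewrite /rnorm normrN. Qed.

End theory.

Lemma rnormZ (V : normedModType K) (a : K) (x : V) :
  rnorm (a *: x) = rnorm (a : K^o) * rnorm x.
Proof.
apply: (@of_real_inj R k).
by rewrite of_realM !rnormE normrZ.
Qed.

Lemma rnorm_of_real (a : R) : 0 <= a -> rnorm (of_real k a : K^o) = a.
Proof. by move=> a0; rewrite /rnorm /= of_real_norm// of_realK. Qed.

Lemma rnorm_sum (V : normedModType K) (u : nat -> V) n :
  rnorm (\sum_(0 <= i < n) u i) <= \sum_(0 <= i < n) rnorm (u i).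
Proof.
elim: n => [|n ih]; first by rewrite !big_nil rnorm0.
by rewrite !big_nat_recr//= (le_trans (rnormD _ _))// lerD2r.
Qed.

Lemma rnorm_cvg_le (V : normedModType K) (u : nat -> V) (l : V) (M : R) :
  u @ \oo --> l -> (forall n, rnorm (u n) <= M) -> rnorm l <= M.
Proof.
move=> /cvgrPdist_lt ul uM; apply/ler_addgt0Pr => e e0.
have e0' : 0 < of_real k e by rewrite -of_real0 ltr_of_real.
have [n _ /(_ n (leqnn n))] := ul _ e0'.
rewrite -rnormE ltr_of_real /= => h.
rewrite -(subrK (u n) l) addrC (le_trans (rnormD _ _))//.
by rewrite lerD ?uM// ltW.
Qed.

Section operators.
Context {V W : normedModType K}.

Lemma rnorm_bounded_continuous (f : V -> W) : linear f ->
  (exists C, forall x, rnorm (f x) <= C * rnorm x) -> continuous f.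
Proof.
move=> lf [C fC] x.
pose g : {linear V -> W} := HB.pack f (GRing.isLinear.Build _ _ _ _ _ lf).
apply: (@bounded_linear_continuous _ _ _ g).
apply/(@linear_boundedP _ _ _ g); near=> r => y.
have fy := fC y.
rewrite -(@ler_of_real _ k) of_realM !rnormE in fy.
apply: (le_trans fy); rewrite ler_wpM2r//.
by near: r; apply: nbhs_pinfty_ge; exact: of_real_real.
Unshelve. all: by end_near. Qed.

Lemma continuous_rnorm_bounded (f : V -> W) : linear f -> continuous f ->
  exists2 C, 0 <= C & forall x, rnorm (f x) <= C * rnorm x.
Proof.
move=> lf cf.
pose g : {linear V -> W} := HB.pack f (GRing.isLinear.Build _ _ _ _ _ lf).
have /linear_boundedP : bounded_near g (nbhs 0).
  by apply: continuous_linear_bounded; exact: cf.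
move=> /pinfty_ex_gt0[r r0 fr]; exists (re_scalar r).
  by rewrite -(@ler_of_real _ k) of_real0 re_scalarK; exact: ltW.
move=> x; rewrite -(@ler_of_real _ k) of_realM !rnormE.
by rewrite re_scalarK; [exact: fr|exact: ltW].
Qed.

End operators.
End rnorm.

Section sup_norm.
Context {R : realType} {k : scalar_kind} {T : Type}.
Local Notation K := (scalars R k).
Context {Y : normedModType K}.
Implicit Types (D : set T) (f g : T -> Y).

Definition sup_norm D f : R := sup [set rnorm (f t) | t in D].

Definition bounded_on D f := exists C, forall t, D t -> rnorm (f t) <= C.

Lemma sup_norm_ub D f t : bounded_on D f -> D t -> rnorm (f t) <= sup_norm D f.
Proof.
move=> [C fC] Dt; apply: ub_le_sup; last by exists t.
by exists C => _ [s Ds <-]; exact: fC.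
Qed.

Lemma sup_norm_le D f C : D !=set0 -> (forall t, D t -> rnorm (f t) <= C) ->
  sup_norm D f <= C.
Proof.
move=> [t Dt] fC; apply: ge_sup; first by exists (rnorm (f t)), t.
by move=> _ [s Ds <-]; exact: fC.
Qed.

Lemma sup_norm_ge0 D f : D !=set0 -> bounded_on D f -> 0 <= sup_norm D f.
Proof.
by move=> [t Dt] bf; apply: le_trans (sup_norm_ub bf Dt); exact: rnorm_ge0.
Qed.

Lemma sup_normD D f g : D !=set0 -> bounded_on D f -> bounded_on D g ->
  sup_norm D (fun t => f t + g t) <= sup_norm D f + sup_norm D g.
Proof.
move=> D0 bf bg; apply: sup_norm_le => // t Dt.
by rewrite (le_trans (rnormD _ _))// lerD// sup_norm_ub.
Qed.

Lemma sup_normZ_le D f (a : K) : D !=set0 -> bounded_on D f ->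
  sup_norm D (fun t => a *: f t) <= rnorm (a : K^o) * sup_norm D f.
Proof.
move=> D0 bf; apply: sup_norm_le => // t Dt.
by rewrite rnormZ ler_wpM2l ?rnorm_ge0// sup_norm_ub.
Qed.

Lemma bounded_onZ D f (a : K) : bounded_on D f ->
  bounded_on D (fun t => a *: f t).
Proof.
move=> [C fC]; exists (rnorm (a : K^o) * C) => t Dt.
by rewrite rnormZ ler_wpM2l ?rnorm_ge0// fC.
Qed.

Lemma sup_normZ D f (a : K) : D !=set0 -> bounded_on D f ->
  sup_norm D (fun t => a *: f t) = rnorm (a : K^o) * sup_norm D f.
Proof.
move=> D0 bf; apply/eqP; rewrite eq_le sup_normZ_le//=.
have [->|a0] := eqVneq a 0.
  rewrite (@rnorm0 _ _ K^o) mul0r sup_norm_ge0//.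
  exact: (bounded_onZ 0 bf).
have := @sup_normZ_le D (fun t => a *: f t) a^-1 D0 (bounded_onZ a bf).
rewrite (_ : (fun t => _) = f); last first.
  by apply/funext => t; rewrite scalerA mulVf// scale1r.
have ra : 0 < rnorm (a : K^o).
  rewrite lt_neqAle rnorm_ge0 andbT eq_sym.
  by apply: contra_neq a0; exact: (@rnorm_eq0 _ _ K^o).
have raV : rnorm (a^-1 : K^o) * rnorm (a : K^o) = 1.
  rewrite -(@rnormZ _ _ K^o) /GRing.scale/= mulVf//.
  by rewrite -(@of_real1 _ k) rnorm_of_real.
move=> /(ler_wpM2l (ltW ra)) /le_trans; apply.
by rewrite mulrA (mulrC (rnorm a)) raV mul1r.
Qed.

Lemma sup_norm_eq0 D f : bounded_on D f -> sup_norm D f = 0 ->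
  forall t, D t -> f t = 0.
Proof.
move=> bf f0 t Dt; apply: rnorm_eq0; apply/eqP; rewrite eq_le rnorm_ge0 andbT.
by rewrite -f0 sup_norm_ub.
Qed.

End sup_norm.

Section clin.
Context {R : realType} {k : scalar_kind}.
Local Notation K := (scalars R k).
Variables V W : normedModType K.

Definition is_clin (f : V -> W) : bool := `[< linear f /\ continuous f >].

(* The space L(V; W), with the operator norm as its normedModType structure. *)
Record clin := CLin {
  clin_fun :> V -> W ;
  clin_subproof : clin_fun \in is_clin }.

HB.instance Definition _ := [isSub for clin_fun].
HB.instance Definition _ := [Choice of clin by <:].

Lemma is_clinP f : reflect (linear f /\ continuous f) (f \in is_clin).
Proof. exact: asboolP. Qed.

Lemma clin_submod_closed : submod_closed is_clin.
Proof.
split=> [|a f g fS gS]; apply/is_clinP; last first.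
  have /is_clinP[lf cf] := fS; have /is_clinP[lg cg] := gS; split.
    move=> b x y; rewrite !fctE lf lg !scalerDr !scalerA (mulrC b).
    by rewrite addrACA.
  by move=> x; apply: cvgD; [apply: cvgZr; exact: cf|exact: cg].
split; last exact: cst_continuous.
by move=> a x y; rewrite scaler0 addr0.
Qed.

HB.instance Definition _ :=
  GRing.isSubmodClosed.Build K (V -> W) is_clin clin_submod_closed.
HB.instance Definition _ := [SubChoice_isSubLmodule of clin by <:].

Lemma clin_linear (f : clin) : linear f.
Proof. by have /is_clinP[] := clin_subproof f. Qed.

Lemma clin_continuous (f : clin) : continuous f.
Proof. by have /is_clinP[] := clin_subproof f. Qed.

Lemma clinP (f g : clin) : f =1 g -> f = g.
Proof. by move=> fg; apply/val_inj/funext. Qed.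

Lemma clin0 (f : clin) : f 0 = 0.
Proof.
by have := clin_linear f (-1) 0 0; rewrite scaler0 addr0 scaleN1r addNr.
Qed.

Definition unit_ball : set V := [set x | rnorm x <= 1].

Definition clin_norm (f : clin) : R := sup_norm unit_ball f.

Lemma unit_ball_neq0 : unit_ball !=set0.
Proof. by exists 0; rewrite /unit_ball/= rnorm0. Qed.

Lemma clin_bounded (f : clin) : bounded_on unit_ball f.
Proof.
have [C C0 fC] := continuous_rnorm_bounded (clin_linear f) (@clin_continuous f).
by exists C => x x1; rewrite (le_trans (fC x))// ler_piMr.
Qed.

Lemma clinZ (f : clin) a x : f (a *: x) = a *: f x.
Proof. by have := clin_linear f a x 0; rewrite clin0 !addr0. Qed.

Lemma clinD (f : clin) x y : f (x + y) = f x + f y.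
Proof. by have := clin_linear f 1 x y; rewrite !scale1r. Qed.

Lemma normalize_ball (x : V) : exists2 a : K, a != 0 & unit_ball (a *: x).
Proof.
have [->|x0] := eqVneq x 0.
  by exists 1; rewrite ?oner_neq0// /unit_ball/= scaler0 rnorm0.
exists (`|x|^-1); first by rewrite invr_eq0 normr_eq0.
rewrite /unit_ball/= -(@ler_of_real _ k) rnormE of_real1 normrZ normfV.
by rewrite normr_id mulVf// normr_eq0.
Qed.

Fact clin_normD (f g : clin) :
  of_real k (clin_norm (f + g)) <=
  of_real k (clin_norm f) + of_real k (clin_norm g).
Proof.
rewrite -of_realD ler_of_real.
exact: sup_normD unit_ball_neq0 (clin_bounded f) (clin_bounded g).
Qed.

Fact clin_normZ (a : K) (f : clin) :
  of_real k (clin_norm (a *: f)) = `|a| * of_real k (clin_norm f).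
Proof.
rewrite -(@rnormE _ _ K^o) -of_realM; congr of_real.
exact: sup_normZ unit_ball_neq0 (clin_bounded f).
Qed.

Fact clin_norm_eq0 (f : clin) : of_real k (clin_norm f) = 0 -> f = 0.
Proof.
rewrite -(@of_real0 _ k) => /of_real_inj f0; apply: clinP => x.
have [a a0 xa] := normalize_ball x.
have := sup_norm_eq0 (clin_bounded f) f0 xa.
by rewrite clinZ => /eqP; rewrite scaler_eq0 (negbTE a0)/= => /eqP.
Qed.

HB.instance Definition _ :=
  Lmodule_isNormed.Build K clin clin_normD clin_normZ clin_norm_eq0.

Lemma rnorm_clin (f : clin) : rnorm f = clin_norm f.
Proof. by apply: (@of_real_inj R k); rewrite rnormE. Qed.

End clin.

Lemma clin_le (R : realType) k (V W : normedModType (scalars R k))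
  (f : clin V W) x : rnorm (f x) <= rnorm f * rnorm x.
Proof.
have [->|x0] := eqVneq x 0; first by rewrite clin0 !rnorm0 mulr0.
rewrite -(@ler_of_real _ k) of_realM !rnormE -ler_pdivrMr ?normr_gt0//.
have xb : unit_ball (`|x|^-1 *: x).
  rewrite /unit_ball/= -(@ler_of_real _ k) rnormE of_real1 normrZ normfV.
  by rewrite normr_id mulVf// normr_eq0.
have := sup_norm_ub (clin_bounded f) xb.
rewrite -/(clin_norm f) clinZ -(@ler_of_real _ k) rnormE normrZ normfV.
by rewrite normr_id mulrC.
Qed.

Definition dual (R : realType) (k : scalar_kind)
    (V : normedModType (scalars R k)) : normedModType (scalars R k) :=
  clin V (scalars R k)^o.

Section approximation_property.
Context {R : realType} {k : scalar_kind}.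
Local Notation K := (scalars R k).

Definition finite_rank (V W : normedModType K) (T : V -> W) :=
  exists (m : nat) (w : 'I_m -> W),
    forall x, exists c : 'I_m -> K, T x = \sum_(i < m) c i *: w i.

Definition approximation_property (V : normedModType K) :=
  forall (C : set V) (e : R), compact C -> 0 < e ->
    exists2 T : clin V V, finite_rank T & forall x, C x -> rnorm (T x - x) <= e.

Definition isometric_isomorphism (V W : normedModType K) (f : V -> W) :=
  [/\ linear f, forall x, `|f x| = `|x| & bijective f].

End approximation_property.

Section mlin.
Context {R : realType} {k : scalar_kind}.
Local Notation K := (scalars R k).
Context {n : nat}.
Variables (E : 'I_n -> normedModType K) (F : normedModType K).

(* dfwith x i t is the family x whose i-th entry is replaced by t. *)
Definition multilinear (A : (forall i, E i) -> F) :=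
  forall (i : 'I_n) (x : forall j, E j),
    linear (fun t : E i => A (dfwith x i t)).

Definition is_mlin (A : (forall i, E i) -> F) : bool :=
  `[< multilinear A /\ continuous (A : prod_topology E -> F) >].

(* The space L(E_1, ..., E_n; F), with norm sup of |A x| over |x_i| <= 1. *)
Record mlin := MLin {
  mlin_fun :> (forall i, E i) -> F ;
  mlin_subproof : mlin_fun \in is_mlin }.

HB.instance Definition _ := [isSub for mlin_fun].
HB.instance Definition _ := [Choice of mlin by <:].

Lemma is_mlinP A : reflect
  (multilinear A /\ continuous (A : prod_topology E -> F)) (A \in is_mlin).
Proof. exact: asboolP. Qed.

Lemma mlin_submod_closed : submod_closed is_mlin.
Proof.
split=> [|a f g fS gS]; apply/is_mlinP; last first.
  have /is_mlinP[lf cf] := fS; have /is_mlinP[lg cg] := gS; split.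
    move=> i x b u v; rewrite !fctE lf lg !scalerDr !scalerA (mulrC b).
    by rewrite addrACA.
  move=> x; have FF := @nbhs_filter (prod_topology E) x.
  by apply: cvgD; [apply: cvgZr; exact: cf|exact: cg].
split; last exact: (@cst_continuous (prod_topology E) F 0).
by move=> i x a u v; rewrite scaler0 addr0.
Qed.

HB.instance Definition _ :=
  GRing.isSubmodClosed.Build K ((forall i, E i) -> F) is_mlin
    mlin_submod_closed.
HB.instance Definition _ := [SubChoice_isSubLmodule of mlin by <:].

Lemma mlin_multilinear (A : mlin) : multilinear A.
Proof. by have /is_mlinP[] := mlin_subproof A. Qed.

Lemma mlin_continuous (A : mlin) : continuous (A : prod_topology E -> F).
Proof. by have /is_mlinP[] := mlin_subproof A. Qed.

Lemma mlinP (A B : mlin) : A =1 B -> A = B.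
Proof. by move=> AB; apply/val_inj/funext. Qed.

Definition poly_ball : set (forall i, E i) :=
  [set x | forall i, rnorm (x i) <= 1].

Definition mlin_norm (A : mlin) : R := sup_norm poly_ball A.

Lemma poly_ball_neq0 : poly_ball !=set0.
Proof. by exists (fun=> 0) => i; rewrite rnorm0. Qed.

Lemma multilinear0 (A : (forall i, E i) -> F) i (x : forall j, E j) :
  multilinear A -> A (dfwith x i (0 : E i)) = 0.
Proof.
move=> lA; have := lA i x (-1) 0 0.
by rewrite scaler0 addr0 scaleN1r addNr.
Qed.

Lemma multilinearZ (A : (forall i, E i) -> F) (c : K) (x : forall i, E i) :
  multilinear A -> A (fun i => c *: x i) = c ^+ n *: A x.
Proof.
move=> lA.
pose y m : forall i, E i := fun i => if (i < m)%N then c *: x i else x i.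
suff Ay m : (m <= n)%N -> A (y m) = c ^+ m *: A x.
  rewrite -Ay//; congr (A _); apply: functional_extensionality_dep => i.
  by rewrite /y ltn_ord.
elim: m => [_|m ih mn].
  by rewrite expr0 scale1r; congr (A _); apply: functional_extensionality_dep.
pose i := Ordinal mn.
have yS : y m.+1 = dfwith (y m) i (c *: x i : E i).
  apply: functional_extensionality_dep => j; case: dfwithP => [|j' ij].
    by rewrite /y ltnS leqnn.
  rewrite /y ltnS leq_eqVlt (_ : (j' == m :> nat) = false)//.
  by apply/negbTE; apply: contra_neq ij => jm; apply/val_inj.
have ym : y m = dfwith (y m) i (x i : E i).
  apply: functional_extensionality_dep => j; case: dfwithP => [|j' ij]//.
  by rewrite /y ltnn.
have := lA i (y m) c (x i) 0.
rewrite addr0 -yS multilinear0// -ym addr0 ih ?(ltnW mn)// => ->.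
by rewrite scalerA exprS.
Qed.

Lemma continuous_poly_bounded (A : (forall i, E i) -> F) :
  continuous (A : prod_topology E -> F) ->
  exists d C, 0 < d /\
    forall x, (forall i, rnorm (x i) < d) -> rnorm (A x) <= C.
Proof.
move=> cA.
pose P (d : R) : set (forall i, E i) := [set x | forall i, rnorm (x i) < d].
pose G : set_system (prod_topology E) :=
  [set U | exists2 d : R, 0 < d & P d `<=` U].
have FG : Filter G.
  split.
  - by exists 1.
  - move=> U V [d d0 dU] [e e0 eV]; exists (Num.min d e).
      by rewrite lt_min d0.
    move=> x xP; split; [apply: dU|apply: eV] => i;
      by have := xP i; rewrite lt_min => /andP[].
  - by move=> U V UV [d d0 dU]; exists d => // x /dU; exact: UV.
have G0 : G --> ((fun=> 0) : prod_topology E).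
  apply/cvg_sup => i U; rewrite nbhsE => -[B [[C oC <-] B0] sBU].
  have /nbhs_norm0P [e /= e0 eC] : nbhs (0 : E i) C by exact: open_nbhs_nbhs.
  exists (re_scalar e).
    by rewrite -(@ltr_of_real _ k) of_real0 re_scalarK// ltW.
  move=> x /(_ i); rewrite -(@ltr_of_real _ k) rnormE re_scalarK ?ltW// => xe.
  by apply: sBU; apply: eC.
have := cA (fun=> 0).
move=> /cvgrPdist_lt /(_ 1 ltr01) /G0 [d d0 dA].
exists d, (1 + rnorm (A (fun=> 0))); split=> // x /dA /=.
rewrite -rnormE -(@of_real1 _ k) ltr_of_real => /ltW.
rewrite -rnormN opprB => h.
by rewrite -(subrK (A (fun=> 0)) (A x)) (le_trans (rnormD _ _))// lerD2r.
Qed.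

Lemma mlin_bounded (A : mlin) : bounded_on poly_ball A.
Proof.
have [d [C [d0 dC]]] := continuous_poly_bounded (@mlin_continuous A).
have d20 : 0 < d / 2 by rewrite divr_gt0.
pose c := of_real k (d / 2).
have c0 : c != 0 by rewrite /c -(@of_real0 _ k) (inj_eq of_real_inj) gt_eqF.
exists (rnorm ((c ^+ n)^-1 : K^o) * C) => x x1.
have -> : A x = (c ^+ n)^-1 *: (A (fun i => c *: x i)).
  rewrite multilinearZ; last exact: mlin_multilinear.
  by rewrite scalerA mulVf ?scale1r// expf_neq0.
rewrite rnormZ ler_wpM2l ?rnorm_ge0// dC// => i.
rewrite rnormZ rnorm_of_real ?ltW//.
apply: (@le_lt_trans _ _ (d / 2)); first by rewrite ler_piMr// ltW.
by rewrite ltr_pdivrMr// ltr_pMr// ltr1n.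
Qed.

Lemma normalize_poly_ball (x : forall i, E i) :
  exists2 a : K, a != 0 & poly_ball (fun i => a *: x i).
Proof.
pose s := 1 + \sum_i rnorm (x i).
have s0 : 0 < s by rewrite ltr_wpDr// sumr_ge0// => i _; exact: rnorm_ge0.
exists (of_real k s^-1).
  by rewrite -(@of_real0 _ k) (inj_eq of_real_inj) gt_eqF// invr_gt0.
move=> i; rewrite rnormZ rnorm_of_real; last by rewrite invr_ge0 ltW.
rewrite mulrC ler_pdivrMr//.
rewrite mul1r /s (bigD1 i)//= addrCA ler_wpDr// addr_ge0// sumr_ge0// => j _.
exact: rnorm_ge0.
Qed.

Fact mlin_normD (A B : mlin) :
  of_real k (mlin_norm (A + B)) <=
  of_real k (mlin_norm A) + of_real k (mlin_norm B).
Proof.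
rewrite -of_realD ler_of_real.
exact: sup_normD poly_ball_neq0 (mlin_bounded A) (mlin_bounded B).
Qed.

Fact mlin_normZ (a : K) (A : mlin) :
  of_real k (mlin_norm (a *: A)) = `|a| * of_real k (mlin_norm A).
Proof.
rewrite -(@rnormE _ _ K^o) -of_realM; congr of_real.
exact: sup_normZ poly_ball_neq0 (mlin_bounded A).
Qed.

Fact mlin_norm_eq0 (A : mlin) : of_real k (mlin_norm A) = 0 -> A = 0.
Proof.
rewrite -(@of_real0 _ k) => /of_real_inj A0; apply: mlinP => x.
have [a a0 xa] := normalize_poly_ball x.
have := sup_norm_eq0 (mlin_bounded A) A0 xa.
rewrite multilinearZ; last exact: mlin_multilinear.
move=> /eqP; rewrite scaler_eq0 expf_eq0 (negbTE a0) andbF/= => /eqP ->.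
by [].
Qed.

HB.instance Definition _ :=
  Lmodule_isNormed.Build K mlin mlin_normD mlin_normZ mlin_norm_eq0.

Lemma rnorm_mlin (A : mlin) : rnorm A = mlin_norm A.
Proof. by apply: (@of_real_inj R k); rewrite rnormE. Qed.

End mlin.

Section interleave.

Definition interleave {T} (f g : nat -> T) (j : nat) : T :=
  if odd j then g j./2 else f j./2.

Lemma map_interleave {T T'} (h : T -> T') (f g : nat -> T) j :
  h (interleave f g j) = interleave (h \o f) (h \o g) j.
Proof. by rewrite /interleave; case: ifP. Qed.

Lemma series_interleave {V : zmodType} (f g : nat -> V) N :
  series (interleave f g) N = series f (uphalf N) + series g N./2.
Proof.
elim: N => [|N ih]; first by rewrite /series/= !big_geq// addr0.
have SS (u : nat -> V) m : series u m.+1 = series u m + u m.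
  by rewrite /series/= big_nat_recr.
rewrite SS ih /interleave /= uphalf_half; case: (odd N) => /=.
  by rewrite add1n (SS g) addrA.
by rewrite add0n (SS f) addrAC.
Qed.

Lemma cvg_interleave {K : numFieldType} {V : normedModType K}
    (f g : nat -> V) a b :
  series f @ \oo --> a -> series g @ \oo --> b ->
  series (interleave f g) @ \oo --> a + b.
Proof.
move=> fa gb.
rewrite (_ : series _ = (fun N => series f (uphalf N) + series g N./2));
  last first.
  by apply/funext => N; rewrite series_interleave.
have half_oo : half @ \oo --> \oo.
  move=> U [N _ NU]; exists N.*2 => // m /= Nm; apply: NU => /=.
  by rewrite -(doubleK N) half_leq.
have uphalf_oo : uphalf @ \oo --> \oo.
  move=> U [N _ NU]; exists N.*2 => // m /= Nm; apply: NU => /=.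
  by rewrite uphalf_half (leq_trans _ (leq_addl _ _))// -(doubleK N) half_leq.
exact: (cvgD (cvg_comp uphalf (series f) uphalf_oo fa)
             (cvg_comp half (series g) half_oo gb)).
Qed.

Lemma cvg_series_single {K : numFieldType} {V : normedModType K}
    (v : V) (u : nat -> V) :
  u 0 = v -> (forall j, u j.+1 = 0) -> series u @ \oo --> v.
Proof.
move=> u0 uS; apply: cvg_near_cst; exists 1%N => // -[//|m] _ /=.
by rewrite /series/= big_nat_recl//= u0 big1 ?addr0.
Qed.

End interleave.

Section hyper_nuclear.
Context {R : realType} {k : scalar_kind}.
Local Notation K := (scalars R k).
Context {n : nat}.
Variables (E : 'I_n -> normedModType K) (F : normedModType K).
Implicit Types (l : nat -> K) (B : nat -> mlin E K^o) (y : nat -> F).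

(* (l, B, y) is a hyper-nuclear representation of A. *)
Definition hn_repr (A : mlin E F) l B y : Prop :=
  [/\ cvgn (series (fun j => rnorm (l j : K^o))),
      exists M, forall j, rnorm (B j) <= M,
      exists M, forall j, rnorm (y j) <= M &
      forall x, series (fun j => (l j * B j x) *: y j) @ \oo --> A x].

Definition hn_cost l B y : R :=
  limn (series (fun j => rnorm (l j : K^o) * rnorm (B j) * rnorm (y j))).

Definition hn_costs (A : mlin E F) : set R :=
  [set s | exists l B y, hn_repr A l B y /\ s = hn_cost l B y].

Definition hn_norm (A : mlin E F) : R := inf (hn_costs A).

Definition is_hnuc (A : mlin E F) : bool :=
  `[< exists l B y, hn_repr A l B y >].

Lemma is_hnucP A : reflect (exists l B y, hn_repr A l B y) (A \in is_hnuc).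
Proof. exact: asboolP. Qed.

Lemma hn_cost_cvg A l B y : hn_repr A l B y ->
  cvgn (series (fun j => rnorm (l j : K^o) * rnorm (B j) * rnorm (y j))).
Proof.
move=> [l1 [M BM] [N yN] _].
have M0 : 0 <= M := le_trans (rnorm_ge0 _) (BM 0).
apply: (@series_le_cvg _ _ (fun j => (M * N) * rnorm (l j : K^o))) => [j|j|j|].
- by rewrite !mulr_ge0// rnorm_ge0.
- by rewrite !mulr_ge0 ?rnorm_ge0// (le_trans _ (yN 0))// rnorm_ge0.
- rewrite -mulrA mulrC ler_wpM2r ?rnorm_ge0//.
  by rewrite ler_pM ?rnorm_ge0.
- exact: is_cvg_seriesZ.
Qed.

Lemma hn_cost_partial A l B y N : hn_repr A l B y ->
  series (fun j => rnorm (l j : K^o) * rnorm (B j) * rnorm (y j)) N <=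
  hn_cost l B y.
Proof.
move=> r; apply: nondecreasing_cvgn_le; last exact: hn_cost_cvg r.
apply/nondecreasing_seqP => m; rewrite /series/= big_nat_recr//= lerDl.
by rewrite !mulr_ge0// rnorm_ge0.
Qed.

Lemma hn_cost_ge0 A l B y : hn_repr A l B y -> 0 <= hn_cost l B y.
Proof.
by move=> /(hn_cost_partial 0); rewrite /series/= big_geq.
Qed.

Lemma hn_repr_le A l B y x : hn_repr A l B y -> poly_ball x ->
  rnorm (A x) <= hn_cost l B y.
Proof.
move=> r x1; have [_ _ _ /(_ x) cA] := r.
apply: rnorm_cvg_le cA _ => m.
apply: le_trans (rnorm_sum _ _) _; apply: le_trans (hn_cost_partial m r).
rewrite /series/=; apply: ler_sum_nat => j _.
rewrite rnormZ ler_wpM2r ?rnorm_ge0// (@rnormZ _ _ K^o) ler_wpM2l ?rnorm_ge0//.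
by rewrite rnorm_mlin sup_norm_ub//; exact: mlin_bounded.
Qed.

Lemma hn_repr0 : hn_repr 0 (fun=> 0) (fun=> 0) (fun=> 0).
Proof.
have s0 (V : normedModType K) (u : nat -> V) :
    u = (fun=> 0) -> series u @ \oo --> (0 : V).
  by move=> ->; apply: cvg_series_single.
split.
- apply/cvg_ex; exists 0.
  by apply: (@cvg_series_single R R) => *; exact: (@rnorm0 _ _ K^o).
- by exists 0 => j; rewrite rnorm0.
- by exists 0 => j; rewrite rnorm0.
- by move=> x; apply: s0; apply/funext => j; rewrite mul0r scale0r.
Qed.

Lemma hn_reprD A l B y A' l' B' y' : hn_repr A l B y -> hn_repr A' l' B' y' ->
  let l2 := interleave l l' in
  let B2 := interleave B B' in
  let y2 := interleave y y' in
  hn_repr (A + A') l2 B2 y2 /\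
  hn_cost l2 B2 y2 = hn_cost l B y + hn_cost l' B' y'.
Proof.
move=> r r'; have [l1 [M BM] [N yN] cA] := r.
have [l1' [M' BM'] [N' yN'] cA'] := r'.
move=> l2 B2 y2; split; [split|].
- apply/cvg_ex; exists (limn (series (fun j => rnorm (l j : K^o))) +
                        limn (series (fun j => rnorm (l' j : K^o)))).
  rewrite (_ : (fun j => _) = interleave (fun j => rnorm (l j : K^o))
                                (fun j => rnorm (l' j : K^o))); last first.
    by apply/funext => j; rewrite /l2 /interleave; case: ifP.
  exact: (@cvg_interleave R R).
- exists (Num.max M M') => j; rewrite /B2 /interleave le_max.
  by case: ifP => _; rewrite ?BM ?BM' ?orbT.
- exists (Num.max N N') => j; rewrite /y2 /interleave le_max.
  by case: ifP => _; rewrite ?yN ?yN' ?orbT.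
- move=> x; rewrite (_ : (fun j => _) = interleave
      (fun j => (l j * B j x) *: y j)
      (fun j => (l' j * B' j x) *: y' j)); last first.
    by apply/funext => j; rewrite /l2 /B2 /y2 /interleave; case: ifP.
  exact: cvg_interleave.
- apply/cvg_lim => //; rewrite (_ : (fun j => _) = interleave
     (fun j => rnorm (l j : K^o) * rnorm (B j) * rnorm (y j))
     (fun j => rnorm (l' j : K^o) * rnorm (B' j) * rnorm (y' j))); last first.
    by apply/funext => j; rewrite /l2 /B2 /y2 /interleave; case: ifP.
  by apply: (@cvg_interleave R R); [exact: hn_cost_cvg r|exact: hn_cost_cvg r'].
Qed.

Lemma hn_reprZ (a : K) A l B y : hn_repr A l B y ->
  hn_repr (a *: A) (fun j => a * l j) B y /\
  hn_cost (fun j => a * l j) B y = rnorm (a : K^o) * hn_cost l B y.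
Proof.
move=> r; have [l1 bB by_ cA] := r.
have rZ j : rnorm (a * l j : K^o) = rnorm (a : K^o) * rnorm (l j : K^o).
  exact: (@rnormZ _ _ K^o).
split; [split|] => //.
- under eq_fun do rewrite rZ.
  exact: is_cvg_seriesZ.
- move=> x; rewrite (_ : (fun j => _) =
      (fun j => a *: ((l j * B j x) *: y j))); last first.
    by apply/funext => j; rewrite scalerA mulrA.
  rewrite (_ : series _ =
      (fun N => a *: series (fun j => (l j * B j x) *: y j) N)).
    by apply: cvgZr; exact: cA.
  by apply/funext => N; rewrite /series/= scaler_sumr.
- rewrite /hn_cost.
  under eq_fun do rewrite rZ -!mulrA.
  rewrite (_ : series _ = (rnorm (a : K^o)) *:
     series (fun j => rnorm (l j : K^o) * rnorm (B j) * rnorm (y j))).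
    by apply/cvg_lim => //; apply: cvgZr; exact: hn_cost_cvg r.
  apply/funext => N; rewrite /series/= fctE scaler_sumr.
  by apply: eq_bigr => j _; rewrite -!mulrA.
Qed.

Lemma hnuc_submod_closed : submod_closed is_hnuc.
Proof.
split=> [|a f g fS gS]; apply/is_hnucP.
  by do 3 eexists; exact: hn_repr0.
have /is_hnucP[l [B [y r]]] := fS; have /is_hnucP[l' [B' [y' r']]] := gS.
do 3 eexists; exact: (hn_reprD (hn_reprZ a r).1 r').1.
Qed.

(* The space HN(E_1, ..., E_n; F). Its norm is hn_norm, not the norm inherited
   from mlin E F. *)
Record hnuc := HNuc {
  hnuc_val :> mlin E F ;
  hnuc_subproof : hnuc_val \in is_hnuc }.

HB.instance Definition _ := [isSub for hnuc_val].
HB.instance Definition _ := [Choice of hnuc by <:].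
HB.instance Definition _ :=
  GRing.isSubmodClosed.Build K (mlin E F) is_hnuc hnuc_submod_closed.
HB.instance Definition _ := [SubChoice_isSubLmodule of hnuc by <:].

Lemma hn_norm_le A l B y : hn_repr A l B y -> hn_norm A <= hn_cost l B y.
Proof.
move=> r; apply: ge_inf; last by exists l, B, y.
by exists 0 => _ [l' [B' [y' [r' ->]]]]; exact: hn_cost_ge0 r'.
Qed.

Lemma hn_costs_has_inf (A : hnuc) : has_inf (hn_costs A).
Proof.
split.
  have /is_hnucP[l [B [y r]]] := hnuc_subproof A.
  by exists (hn_cost l B y), l, B, y.
by exists 0 => _ [l' [B' [y' [r' ->]]]]; exact: hn_cost_ge0 r'.
Qed.

Lemma hn_norm_adherent (A : hnuc) e : 0 < e ->
  exists l B y, hn_repr A l B y /\ hn_cost l B y < hn_norm A + e.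
Proof.
move=> e0.
have [_ [l [B [y [r ->]]]] h] := inf_adherent e0 (hn_costs_has_inf A).
by exists l, B, y.
Qed.

Lemma hn_norm_ge0 (A : hnuc) : 0 <= hn_norm A.
Proof.
apply: lb_le_inf; first exact: (hn_costs_has_inf A).1.
by move=> _ [l' [B' [y' [r' ->]]]]; exact: hn_cost_ge0 r'.
Qed.

Lemma mlin_norm_hn (A : hnuc) : rnorm (A : mlin E F) <= hn_norm A.
Proof.
rewrite rnorm_mlin; apply: lb_le_inf; first exact: (hn_costs_has_inf A).1.
move=> _ [l [B [y [r ->]]]]; apply: sup_norm_le; first exact: poly_ball_neq0.
by move=> x; exact: hn_repr_le.
Qed.

Lemma hn_normZ_le (a : K) (A : hnuc) :
  hn_norm (a *: A : hnuc) <= rnorm (a : K^o) * hn_norm A.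
Proof.
apply/ler_addgt0Pr => e e0.
have a1 : 0 < rnorm (a : K^o) + 1 by rewrite ltr_wpDl ?rnorm_ge0.
have ea : 0 < e / (rnorm (a : K^o) + 1) by rewrite divr_gt0.
have [l [B [y [r h]]]] := hn_norm_adherent A ea.
have [r' c'] := hn_reprZ a r.
apply: le_trans (hn_norm_le r') _; rewrite c'.
apply: le_trans (ler_wpM2l (rnorm_ge0 _) (ltW h)) _.
rewrite mulrDr lerD2l mulrA ler_pdivrMr// mulrC ler_pM2l//.
by rewrite lerDl.
Qed.

Fact hnuc_normD (A B : hnuc) :
  of_real k (hn_norm (A + B : hnuc)) <=
  of_real k (hn_norm A) + of_real k (hn_norm B).
Proof.
rewrite -of_realD ler_of_real; apply/ler_addgt0Pr => e e0.
have e20 : 0 < e / 2 by rewrite divr_gt0.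
have [l [C [y [r h]]]] := hn_norm_adherent A e20.
have [l' [C' [y' [r' h']]]] := hn_norm_adherent B e20.
have [r2 c2] := hn_reprD r r'.
apply: le_trans (hn_norm_le r2) _; rewrite c2.
by rewrite (splitr e) addrACA lerD// ltW.
Qed.

Fact hnuc_normZ (a : K) (A : hnuc) :
  of_real k (hn_norm (a *: A : hnuc)) = `|a| * of_real k (hn_norm A).
Proof.
rewrite -(@rnormE _ _ K^o) -of_realM; congr of_real.
apply/eqP; rewrite eq_le hn_normZ_le/=.
have [->|a0] := eqVneq a 0.
  by rewrite (@rnorm0 _ _ K^o) mul0r; exact: (hn_norm_ge0 (0 *: A)).
have := hn_normZ_le a^-1 (a *: A).
rewrite scalerA mulVf// scale1r => h.
apply: le_trans (ler_wpM2l (rnorm_ge0 _) h) _.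
rewrite mulrA -(@rnormZ _ _ K^o) /GRing.scale/= mulfV//.
by rewrite -(@of_real1 _ k) rnorm_of_real// mul1r.
Qed.

Fact hnuc_norm_eq0 (A : hnuc) : of_real k (hn_norm A) = 0 -> A = 0.
Proof.
rewrite -(@of_real0 _ k) => /of_real_inj A0; apply/val_inj => /=.
apply: rnorm_eq0; apply/eqP; rewrite eq_le rnorm_ge0 andbT -A0.
exact: mlin_norm_hn.
Qed.

HB.instance Definition _ :=
  Lmodule_isNormed.Build K hnuc hnuc_normD hnuc_normZ hnuc_norm_eq0.

Lemma rnorm_hnuc (A : hnuc) : rnorm A = hn_norm A.
Proof. by apply: (@of_real_inj R k); rewrite rnormE. Qed.

Lemma tensor_subproof (A : mlin E K^o) (y : F) :
  (fun x => A x *: y) \in @is_mlin R k n E F.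
Proof.
apply/is_mlinP; split.
  move=> i x a u v; have -> := mlin_multilinear A x a u v.
  by rewrite scalerDl scalerA.
move=> x; have FF := @nbhs_filter (prod_topology E) x.
by apply: cvgZl; exact: mlin_continuous.
Qed.

(* A (x) y, first in L(E_1, ..., E_n; F), then in HN(E_1, ..., E_n; F). *)
Definition tensor (A : mlin E K^o) (y : F) : mlin E F :=
  MLin (tensor_subproof A y).

Lemma hn_repr_tensor (A : mlin E K^o) (y : F) :
  hn_repr (tensor A y) (fun j => (j == 0%N)%:R) (fun=> A) (fun=> y) /\
  hn_cost (fun j => (j == 0%N)%:R) (fun=> A) (fun=> y) = rnorm A * rnorm y.
Proof.
have r1 : rnorm (1 : K^o) = 1.
  by rewrite -(@of_real1 _ k) rnorm_of_real.
have r0 := @rnorm0 _ _ K^o.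
split; [split|].
- apply/cvg_ex; exists 1; apply: (@cvg_series_single R R) => //= *.
- by exists (rnorm A).
- by exists (rnorm y).
- move=> x; apply: cvg_series_single => [|j] /=; first by rewrite mul1r.
  by rewrite mul0r scale0r.
- apply/cvg_lim => //; apply: (@cvg_series_single R R) => [|j] /=.
    by rewrite r1 mul1r.
  by rewrite r0 !mul0r.
Qed.

Lemma hn_tensor_subproof (A : mlin E K^o) (y : F) : tensor A y \in is_hnuc.
Proof. by apply/is_hnucP; do 3 eexists; exact: (hn_repr_tensor A y).1. Qed.

Definition hn_tensor (A : mlin E K^o) (y : F) : hnuc :=
  HNuc (hn_tensor_subproof A y).

Lemma rnorm_hn_tensor (A : mlin E K^o) (y : F) :
  rnorm (hn_tensor A y) <= rnorm A * rnorm y.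
Proof.
by have [r <-] := hn_repr_tensor A y; rewrite rnorm_hnuc; exact: hn_norm_le r.
Qed.

Lemma hyper_borel_subproof1 (phi : dual hnuc) (A : mlin E K^o) :
  (fun y : F => phi (hn_tensor A y)) \in @is_clin R k F K^o.
Proof.
have lin : linear (fun y : F => phi (hn_tensor A y) : K^o).
  move=> a u v; rewrite -(clin_linear phi); congr (phi _).
  apply/val_inj/val_inj/funext => x /=.
  by rewrite !fctE scalerDr !scalerA mulrC.
apply/is_clinP; split => //.
apply: rnorm_bounded_continuous => //.
exists (rnorm phi * rnorm A) => y; apply: le_trans (clin_le phi _) _.
by rewrite -mulrA ler_wpM2l ?rnorm_ge0// rnorm_hn_tensor.
Qed.

Definition hyper_borel_fun (phi : dual hnuc) (A : mlin E K^o) : dual F :=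
  CLin (hyper_borel_subproof1 phi A).

Lemma hyper_borel_subproof2 (phi : dual hnuc) :
  hyper_borel_fun phi \in @is_clin R k (mlin E K^o) (dual F).
Proof.
have lin : linear (hyper_borel_fun phi).
  move=> a A B; apply: clinP => y.
  rewrite /= !fctE /= -(clin_linear phi); congr (phi _).
  apply/val_inj/val_inj/funext => x /=.
  by rewrite !fctE scalerDl scalerA.
apply/is_clinP; split => //.
apply: rnorm_bounded_continuous => //.
exists (rnorm phi) => A.
rewrite rnorm_clin; apply: sup_norm_le; first exact: unit_ball_neq0.
move=> y y1 /=; apply: le_trans (clin_le phi _) _.
rewrite ler_wpM2l ?rnorm_ge0//; apply: le_trans (rnorm_hn_tensor _ _) _.
by rewrite ler_piMr ?rnorm_ge0.
Qed.

(* See hyper_borelE for the defining formula. *)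
Definition hyper_borel (phi : dual hnuc) : clin (mlin E K^o) (dual F) :=
  CLin (hyper_borel_subproof2 phi).

Lemma hyper_borelE phi A (y : F) : hyper_borel phi A y = phi (hn_tensor A y).
Proof. by []. Qed.

End hyper_nuclear.

(* Main.v *)
(* Every representation of A converges to A in the hyper-nuclear norm, so
   phi(A) = sum_j l_j B_n(phi)(B_j)(y_j) and |phi(A)| <= |B_n(phi)| |A|_HN,
   whence B_n is isometric.

   Given T : L(E_1, ..., E_n) -> F^*, the preimage must be
   phi(A) = sum_j l_j T(B_j)(y_j), and the point is that this does not depend on
   the representation, i.e. that the sum vanishes when A = 0.  For A = 0 and
   g in F^*, the series sum_j l_j g(y_j) B_j converges in norm and vanishes
   pointwise, so it is 0.  This settles the case of a finite-rank T.  In general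
   write l_j = s_j t_j with s in l_1 and t_j -> 0: the approximation property,
   applied to the compact set {t_j B_j} (or {t_j T(B_j)}) together with 0, gives
   finite-rank U with |(T - U)(t_j B_j)| <= e for all j, and the two sums differ
   by at most e sup_j |y_j| sum_j |s_j|. *)
Require Import Defs.
From mathcomp Require Import all_boot all_order all_algebra.
From mathcomp Require Import complex.
From mathcomp Require Import boolp classical_sets functions cardinality.
From mathcomp Require Import reals topology normedtype.
From mathcomp Require Import sequences realfun.
Set Implicit Arguments.
Unset Strict Implicit.
Unset Printing Implicit Defensive.
Import Order.TTheory GRing.Theory Num.Theory.
Import numFieldNormedType.Exports.
Local Open Scope classical_set_scope.
Local Open Scope ring_scope.

(** * Compactness of convergent sequences; splitting a null factor off a summable sequence *)

Lemma compact_cvg_range (T : topologicalType) (u : nat -> T) (l : T) :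
  u @ \oo --> l -> compact ([set l] `|` range u).
Proof.
move=> ul F PF FA; case: (pselect (cluster F l)) => [Fl|].
  by exists l; split => //; left.
(* When [l] is not a cluster point, some member of [F] avoids a neighbourhood of [l], so [F]
   concentrates on finitely many terms of [u], a compact set. *)
move=> /existsNP[A] /existsNP[B] /not_implyP[FAA] /not_implyP[lB] AB0.
have [N _ NB] := ul _ lB.
have /finite_compact cN : finite_set (u @` `I_N) by exact/finite_image.
have FN : F (u @` `I_N).
  apply: filterS (filterI FA FAA) => x [[->|[j _ <-]] Ax].
    by exfalso; apply: AB0; exists l; split => //; exact: nbhs_singleton.
  exists j => //=; rewrite ltnNge; apply/negP => Nj; apply: AB0.
  by exists (u j); split => //; exact: NB.
have [x [[j _ <-] Fx]] := cN F PF FN.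
by exists (u j); split => //; right; exists j.
Qed.

(* [t j] is the square root of the [j]-th tail [r j] of the series of [a]:
   [a j = r j - r j.+1] is at most [2 * t j * (t j - t j.+1)]. *)
Lemma summable_div_null (R : realType) (a : nat -> R) :
  (forall j, 0 <= a j) -> cvgn (series a) ->
  exists t : nat -> R, [/\ forall j, 0 <= t j, t @ \oo --> 0,
    forall j, t j = 0 -> a j = 0 &
    exists M, forall N, series (fun j => a j / t j) N <= M].
Proof.
move=> a0 ca; set r := fun j => limn (series a) - series a j.
have ndS : nondecreasing_seq (series a).
  by apply/nondecreasing_seqP => m; rewrite seriesSr lerDl.
have r0 j : 0 <= r j by rewrite subr_ge0 nondecreasing_cvgn_le.
have rS j : r j = a j + r j.+1.
  by rewrite /r seriesSr [RHS]addrC -addrA opprD subrK.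
pose t j := Num.sqrt (r j).
have t0 j : 0 <= t j by exact: sqrtr_ge0.
have cr : r @ \oo --> 0.
  by rewrite -(subrr (limn (series a))); apply: cvgB => //; exact: cvg_cst.
exists t; split => //.
- rewrite -[0]sqrtr0; apply: continuous_cvg => //; exact: sqrt_continuous.
- move=> j /eqP; rewrite sqrtr_eq0 => rj; apply/eqP.
  by rewrite eq_le a0 andbT (le_trans _ rj)// rS lerDl.
exists (2 * t 0) => N.
suff : series (fun j => a j / t j) N <= 2 * (t 0 - t N).
  by move=> /le_trans; apply; rewrite ler_pM2l// gerBl.
elim: N => [|N ih]; first by rewrite /series/= big_geq// subrr mulr0.
rewrite seriesSr -[t 0%N - _](subrKA (t N)) mulrDr; apply: lerD => //=.
(* Division by zero returns [0], so an index with [t N = 0] adds nothing to the series. *)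
have [tN|tN] := eqVneq (t N) 0.
  rewrite tN invr0 mulr0 sub0r; rewrite mulr_ge0// oppr_ge0 -tN ler_wsqrtr//.
  by rewrite [leRHS]rS lerDr.
rewrite ler_pdivrMr; last by rewrite lt_neqAle eq_sym tN t0.
have tNS : t N.+1 <= t N by rewrite ler_wsqrtr// [leRHS]rS lerDr.
have -> : a N = (t N - t N.+1) * (t N + t N.+1).
  by rewrite -subr_sqr !sqr_sqrtr// rS addrK.
by rewrite [2 * _]mulrC -mulrA ler_wpM2l ?subr_ge0// mulr_natl mulr2n lerD2l.
Qed.

(** * Convergence measured by real-valued norms, and absolute convergence of scalar series *)

Section rnorm_convergence.
Context {R : realType} {k : scalar_kind}.
Local Notation K := (scalars R k).
Implicit Type V : normedModType K.

Lemma rnorm_cvg0 V (u : nat -> V) (l : V) :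
  u @ \oo --> l -> (fun n => rnorm (l - u n)) @ \oo --> (0 : R).
Proof.
move=> /cvgrPdist_lt ul; apply/cvgrPdist_lt => e e0.
have e0' : 0 < of_real k e by rewrite -of_real0 ltr_of_real.
apply: filterS (ul _ e0') => n /=.
by rewrite -rnormE ltr_of_real sub0r normrN ger0_norm// rnorm_ge0.
Qed.

Lemma squeeze_rnorm V (u : nat -> V) (l : V) (e : nat -> R) :
  e @ \oo --> 0 -> (forall n, rnorm (l - u n) <= e n) -> u @ \oo --> l.
Proof.
move=> /cvgrPdist_lt e0 ue; apply/cvgrPdist_lt => d d0.
have d0' : 0 < re_scalar d.
  by rewrite -(@ltr_of_real _ k) of_real0 re_scalarK// ltW.
apply: filterS (e0 _ d0') => n /=; rewrite sub0r normrN => en.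
rewrite -rnormE -(re_scalarK (ltW d0)) ltr_of_real (le_lt_trans (ue n))//.
by rewrite (le_lt_trans (ler_norm _)).
Qed.

Lemma rnorm_series_le V (u : nat -> V) n :
  rnorm (series u n) <= series (fun j => rnorm (u j)) n.
Proof. exact: rnorm_sum. Qed.

End rnorm_convergence.

(** Over [R[i]], completeness is inherited from [R]: real and imaginary parts are dominated by the
    modulus, hence converge absolutely, and their limits recombine. *)
Lemma cvg_abs_series (R : realType) (k : scalar_kind)
    (u : nat -> (scalars R k)^o) :
  cvgn (series (fun j => rnorm (u j))) -> cvgn (series u).
Proof.
case: k u => u cu; first exact: normed_cvg.
have rE (z : R[i]) : rnorm (z : (scalars R ComplexScalars)^o) =
    Num.sqrt (complex.Re z ^+ 2 + complex.Im z ^+ 2).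
  exact: (congr1 (@complex.Re R) (normc_def z)).
have le_part (f : R[i] -> R) :
    (forall z : R[i], f z ^+ 2 <= complex.Re z ^+ 2 + complex.Im z ^+ 2) ->
    cvgn (series (f \o u)).
  move=> fle; apply: normed_cvg; apply: series_le_cvg cu => j.
  - exact: normr_ge0.
  - exact: rnorm_ge0.
  - by rewrite rE [leLHS]/= -sqrtr_sqr ler_wsqrtr.
have /cvg_ex[a ca] : cvgn (series (@complex.Re R \o u)).
  by apply: le_part => z; rewrite lerDl sqr_ge0.
have /cvg_ex[b cb] : cvgn (series (@complex.Im R \o u)).
  by apply: le_part => z; rewrite lerDr sqr_ge0.
apply/cvg_ex; exists (a +i* b)%C.
pose e (v : nat -> R) (c : R) n := `|c - series v n|.
have e0 v c : series v @ \oo --> c -> e v c @ \oo --> 0.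
  exact: (@rnorm_cvg0 R RealScalars R^o).
have cab :
    e (@complex.Re R \o u) a \+ e (@complex.Im R \o u) b @ \oo --> (0 : R).
  by rewrite -[X in _ --> X]addr0; apply: cvgD; exact: e0.
apply: (@squeeze_rnorm R ComplexScalars (scalars R ComplexScalars)^o _
  (a +i* b)%C _ cab) => n.
rewrite rE.
have -> : series u n = (series (@complex.Re R \o u) n +i*
                        series (@complex.Im R \o u) n)%C.
  elim: n => [|n ih]; first by rewrite /series/= !big_geq.
  by rewrite !seriesSr ih /=; case: (u n).
rewrite /e /=; set p := a - _; set q := b - _.
rewrite -[leRHS]ger0_norm ?addr_ge0// -(sqrtr_sqr (`|p| + _)) ler_wsqrtr//.
by rewrite [leRHS]sqrrD !real_normK ?num_real// lerD2r lerDl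
   mulrn_wge0// mulr_ge0//.
Qed.

(** * Finite-rank operators and the approximation property *)

Section finite_rank_operators.
Context {R : realType} {k : scalar_kind}.
Local Notation K := (scalars R k).
Implicit Types V W X : normedModType K.

Lemma clin_scaleE V W (a : K) (f : clin V W) (x : V) : (a *: f) x = a *: f x.
Proof. by []. Qed.

Lemma clin_sumE V W (I : Type) (s : seq I) (f : I -> clin V W) (x : V) :
  (\sum_(i <- s) f i : clin V W) x = \sum_(i <- s) f i x.
Proof. by elim/big_rec2: _ => // i a b _ <-. Qed.

Lemma clin_series V W (f : clin V W) (u : nat -> V) N :
  f (series u N) = series (f \o u) N.
Proof.
elim: N => [|N ih]; first by rewrite /series/= !big_geq// clin0.
by rewrite !seriesSr clinD ih.
Qed.

Lemma clinN V W (f : clin V W) (x : V) : f (- x) = - f x.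
Proof. by rewrite -scaleN1r clinZ scaleN1r. Qed.

Lemma clinB V W (f : clin V W) (x y : V) : f (x - y) = f x - f y.
Proof. by rewrite clinD clinN. Qed.

Lemma clin_comp_subproof V W X (g : clin W X) (f : clin V W) :
  g \o f \in @is_clin R k V X.
Proof.
apply/is_clinP; split=> [a x y|x]; first by rewrite /= !clin_linear.
by apply: continuous_comp; exact: clin_continuous.
Qed.

Definition clin_comp V W X (g : clin W X) (f : clin V W) : clin V X :=
  CLin (clin_comp_subproof g f).

Lemma finite_rank_compl V W X (g : clin W X) (f : clin V W) :
  finite_rank f -> finite_rank (clin_comp g f).
Proof.
move=> [m [w fw]]; exists m, (g \o w) => x /=; have [c ->] := fw x; exists c.
elim/big_rec2: _ => [|i a b _ /= <-]; first exact: clin0.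
by rewrite -clin_linear.
Qed.

Lemma finite_rank_compr V W X (g : clin W X) (f : clin V W) :
  finite_rank g -> finite_rank (clin_comp g f).
Proof. by move=> [m [w gw]]; exists m, w => x; exact: gw. Qed.

(* A finite-dimensional subspace of [dual V] is determined by finitely many
   point evaluations; this makes the coordinates of a continuous finite-rank
   operator into [dual V] continuous without a choice of a basis. *)
Lemma dual_span_eval V m (w : 'I_m -> dual V) :
  exists s : seq (V * dual V), forall c : 'I_m -> K,
    let v : dual V := \sum_(i < m) c i *: w i in
    v = \sum_(p <- s) v p.1 *: p.2.
Proof.
elim: m w => [|m ih] w; first by exists [::] => c /=; rewrite big_ord0 big_nil.
have [s sP] := ih (w \o lift ord0).
pose P (v : dual V) : dual V := \sum_(p <- s) v p.1 *: p.2.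
have PD a (u v : dual V) : P (a *: u + v) = a *: P u + P v.
  rewrite /P scaler_sumr -big_split /=; apply: eq_bigr => p _.
  by rewrite scalerA -scalerDl.
(* [P] fixes every combination of the remaining vectors, so [v - P v] is always a multiple of the
   residual [r]; if [r] is zero, the old pairs suffice. *)
pose r := w ord0 - P (w ord0).
have vP c : let v : dual V := \sum_(i < m.+1) c i *: w i in
    v = P v + c ord0 *: r.
  rewrite /= big_ord_recl PD -[P (\sum_(i < m) _)]sP /r.
  by rewrite scalerBr [RHS]addrAC subrKC.
have [r0|/eqP r0] := eqVneq r 0.
  by exists s => c /=; rewrite [LHS]vP r0 scaler0 addr0.
have [y0 /eqP ry0] : exists y0, r y0 <> 0.
  apply: contrapT => /forallNP h; apply: r0; apply: clinP => y.
  exact: contrapT.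
(* Evaluating [v = P v + c ord0 *: r] at [y0] expresses [c ord0] through [v y0] and the values
   [v p.1]; [q] absorbs the latter contribution into the old pairs. *)
pose q (p : V * dual V) : V * dual V := (p.1, p.2 - (p.2 y0 / r y0) *: r).
exists ((y0, (r y0)^-1 *: r : dual V) :: map q s).
move=> c; have := vP c; move: (\sum_(i < _) _) => v /= vE.
rewrite big_cons big_map /=.
under eq_bigr do rewrite scalerBr scalerA.
rewrite sumrB -/(P v) -scaler_suml.
have cE : c ord0 = v y0 / r y0 - \sum_(p <- s) v p.1 * (p.2 y0 / r y0).
  have : v y0 = P v y0 + c ord0 * r y0 by rewrite {1}vE.
  move=> ->; rewrite mulrDl mulfK// clin_sumE mulr_suml addrAC addrC.
  rewrite -sumrB big1 ?addr0// => p _.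
  by rewrite mulrA subrr.
by rewrite {1}vE cE scalerBl addrCA scalerA.
Qed.

(** Writing [U x] as a finite sum of [U x p.1 *: p.2] turns the series into finitely many
    evaluations of [U] at partial sums that tend to [0] by the hypothesis at [g := p.2]. *)
Lemma finite_rank_series_cvg0 V X (l : nat -> K) (B : nat -> X) (y : nat -> V)
    (U : clin X (dual V)) : finite_rank U ->
  (forall g : dual V, series (fun j => (l j * g (y j)) *: B j) @ \oo --> 0) ->
  series (fun j => l j * U (B j) (y j) : K^o) @ \oo --> (0 : K^o).
Proof.
move=> [m [w Uw]] B0; have [s sP] := dual_span_eval w.
have UE x : U x = \sum_(p <- s) U x p.1 *: p.2.
  by have [c ->] := Uw x; exact: sP.
pose S (p : V * dual V) := series (fun j => (l j * p.2 (y j)) *: B j).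
have -> : series (fun j => l j * U (B j) (y j) : K^o) =
    (fun N => \sum_(p <- s) (U (S p N) p.1 : K^o)).
  apply/funext => N; rewrite /series/=.
  under eq_bigr do rewrite UE clin_sumE mulr_sumr.
  rewrite exchange_big; apply: eq_bigr => p _.
  rewrite /S clin_series /series clin_sumE; apply: eq_bigr => j _ /=.
  rewrite clinZ !clin_scaleE /GRing.scale/= -mulrA; congr (_ * _); exact: mulrC.
elim: s {sP UE} => [|p s ih].
  under eq_fun do rewrite big_nil; exact: cvg_cst.
under eq_fun do rewrite big_cons.
have p0 : (fun N => U (S p N) p.1 : K^o) @ \oo --> (0 : K^o).
  apply: squeeze_rnorm (fun N => rnorm (0 - U (S p N)) * rnorm p.1) _ _.
    rewrite -(mul0r (rnorm p.1)); apply: cvgMl; apply: rnorm_cvg0.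
    rewrite -(clin0 U); apply: continuous_cvg; first exact: clin_continuous.
    exact: B0.
  by move=> N; rewrite !sub0r !rnormN clin_le.
have := @cvgD K K^o _ \oo _ _ _ _ _ p0 ih; rewrite addr0 => h; exact: h.
Qed.

(** [T] is composed with a finite-rank approximation of the identity, either before [T], on the
    points [x j], or after [T], on the points [T (x j)]. Both point sets are compact once the limit
    [0] is added. *)
Lemma approx_finite_rank X W (T : clin X W) (x : nat -> X) (e : R) :
  approximation_property X \/ approximation_property W ->
  x @ \oo --> 0 -> 0 < e ->
  exists2 U : clin X W, finite_rank U &
    forall j, rnorm (T (x j) - U (x j)) <= e.
Proof.
move=> ap x0 e0; case: ap => [apX|apW].
  have T1 : 0 < rnorm T + 1 by rewrite ltr_wpDl// rnorm_ge0.
  have [|S fS SP] := apX _ (e / (rnorm T + 1)) (compact_cvg_range x0).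
    by rewrite divr_gt0.
  exists (clin_comp T S); first exact: finite_rank_compl.
  move=> j /=; rewrite -clinB -rnormN -clinN opprB.
  apply: le_trans (clin_le _ _) _.
  apply: le_trans (ler_wpM2l (rnorm_ge0 _) (SP (x j) _)) _.
    by right; exists j.
  by rewrite mulrCA ler_piMr ?(ltW e0)// ler_pdivrMr// mul1r lerDl.
have Tx0 : T \o x @ \oo --> 0.
  by rewrite -(clin0 T); apply: continuous_cvg => //; exact: clin_continuous.
have [S fS SP] := apW _ e (compact_cvg_range Tx0) e0.
exists (clin_comp S T); first exact: finite_rank_compr.
by move=> j /=; rewrite -rnormN opprB; apply: SP; right; exists j.
Qed.

Lemma nuclear_series_cvg0 V X (l : nat -> K) (B : nat -> X) (y : nat -> V)
    (T : clin X (dual V)) :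
  approximation_property X \/ approximation_property (dual V) ->
  cvgn (series (fun j => rnorm (l j : K^o))) ->
  (exists M, forall j, rnorm (B j) <= M) ->
  (exists M, forall j, rnorm (y j) <= M) ->
  (forall g : dual V, series (fun j => (l j * g (y j)) *: B j) @ \oo --> 0) ->
  series (fun j => l j * T (B j) (y j) : K^o) @ \oo --> (0 : K^o).
Proof.
move=> ap cl [M BM] [N yN] B0.
have [t [t0 ct tl [C tC]]] :=
  summable_div_null (fun j => rnorm_ge0 (l j : K^o)) cl.
(* The factor [t j] moves from the coefficient to the operator: [x] is a null sequence because [B]
   is bounded, while the partial sums of [rnorm (l j) / t j] stay below [C]. *)
pose x j := of_real k (t j) *: B j.
have cx : x @ \oo --> 0.
  apply: (@squeeze_rnorm _ _ _ _ _ (fun j => t j * M)).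
    by rewrite -(mul0r M); exact: cvgMl.
  by move=> j; rewrite sub0r rnormN rnormZ rnorm_of_real// ler_wpM2l.
have N0 : 0 <= N := le_trans (rnorm_ge0 _) (yN 0%N).
have C0 : 0 <= C by have := tC 0%N; rewrite /series/= big_geq.
(* With [N] bounding the vectors [y j], the tolerance [e / 2 / D] costs at most [e / 2] in total;
   the other half goes to the finite-rank series. *)
pose D := C * N + 1; have D0 : 0 < D by rewrite ltr_wpDl// mulr_ge0.
apply/cvgrPdist_le => e' e'0.
have e0 : 0 < re_scalar e'.
  by rewrite -(@ltr_of_real _ k) of_real0 re_scalarK// ltW.
rewrite -(re_scalarK (ltW e'0)); move: (re_scalar e') e0 => {e' e'0} e e0.
have d0 : 0 < e / 2 / D by rewrite !divr_gt0.
have [U Ufin UT] := approx_finite_rank T ap cx d0.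
have := rnorm_cvg0 (finite_rank_series_cvg0 Ufin B0).
have e20 : 0 < e / 2 by rewrite divr_gt0.
move=> /cvgrPdist_le /(_ _ e20); apply: filterS => n /=.
rewrite !sub0r !normrN ger0_norm ?rnorm_ge0// => Un.
rewrite -rnormE ler_of_real; set a := series _ _ in Un *.
rewrite -[X in rnorm X](subrK a) (le_trans (rnormD _ _))// [leRHS]splitr lerD//;
  last by rewrite -rnormN.
have -> : series (fun j => l j * T (B j) (y j) : K^o) n - a =
    series (fun j => l j * (T (B j) - U (B j)) (y j) : K^o) n.
  rewrite /a /series/= -sumrB; apply: eq_bigr => j _.
  by rewrite -mulrBr.
apply: le_trans (rnorm_series_le _ _) _.
apply: le_trans
  (_ : series (fun j => rnorm (l j : K^o) / t j) n * (e / 2 / D * N) <= _).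
  rewrite /series/= mulr_suml ler_sum// => j _.
  rewrite (@rnormZ _ _ K^o) -[leRHS]mulrA.
  (* Where [t j] vanishes, so does [l j]; elsewhere multiplication by [t j] turns [B j] into [x j],
     where [U] is close to [T]. *)
  have [tj0|tj0] := eqVneq (t j) 0; first by rewrite tl// !mul0r.
  rewrite ler_wpM2l ?rnorm_ge0// ler_pdivlMl;
    last by rewrite lt_neqAle eq_sym tj0 t0.
  apply: le_trans (_ : rnorm (T (x j) - U (x j)) * rnorm (y j) <= _).
    rewrite -[in leLHS](rnorm_of_real (k := k) (t0 j)) -(@rnormZ _ _ K^o).
    have -> : of_real k (t j) *: ((T (B j) - U (B j)) (y j) : K^o) =
        (T (x j) - U (x j)) (y j) by rewrite /x !clinZ -scalerBr.
    exact: clin_le.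
  by rewrite ler_pM ?rnorm_ge0.
apply: le_trans (_ : C * (e / 2 / D * N) <= _).
  by rewrite ler_wpM2r// mulr_ge0// ltW.
have -> : C * (e / 2 / D * N) = e / 2 * (D^-1 * (C * N)).
  by rewrite mulrCA -!mulrA.
by rewrite ler_piMr ?(ltW e20)// ler_pdivrMl// mulr1 lerDl.
Qed.

End finite_rank_operators.

(** * Surjectivity: the functional induced by an operator into the dual *)

Section hyper_borel_isomorphism.
Context {R : realType} {k : scalar_kind} {n : nat}.
Local Notation K := (scalars R k).
Variables (E : 'I_n -> normedModType K) (F : normedModType K).
Local Notation X := (mlin E K^o).
Local Notation hn := (hnuc E F).
Implicit Types (l : nat -> K) (B : nat -> X) (y : nat -> F).

Lemma mlin_seriesE (u : nat -> X) N x :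
  (series u N : X) x = series (fun j => u j x : K^o) N.
Proof.
elim: N => [|N ih]; first by rewrite /series/= !big_geq.
by rewrite !seriesSr -ih.
Qed.

(* Pointwise convergence to [0] is upgraded to convergence in norm: the partial
   sums form a Cauchy sequence. *)
Lemma mlin_series_cvg0 (u : nat -> X) :
  cvgn (series (fun j => rnorm (u j))) ->
  (forall x, series (fun j => u j x : K^o) @ \oo --> (0 : K^o)) ->
  series u @ \oo --> 0.
Proof.
move=> cu u0; pose s := series (fun j => rnorm (u j)).
have nds : nondecreasing_seq s.
  by apply/nondecreasing_seqP => m; rewrite /s seriesSr lerDl rnorm_ge0.
apply: (@squeeze_rnorm _ _ _ _ _ (fun N => limn s - s N)).
  by rewrite -(subrr (limn s)); apply: cvgB => //; exact: cvg_cst.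
move=> N; rewrite sub0r rnorm_mlin.
apply: sup_norm_le; first exact: poly_ball_neq0.
move=> x x1; set v := (fun j => u j x : K^o).
have -> : (- series u N : X) x = - series v N by rewrite -mlin_seriesE.
(* Since the whole series vanishes at [x], its tail from [N] on sums to [- series v N]; the bound on
   finite sections of the tail does not depend on [x]. *)
have cv : (fun m => series v (N + m)%N - series v N) @ \oo --> - series v N.
  have sh : (fun m => series v (N + m)%N) @ \oo --> (0 : K^o).
    exact: (cvg_comp _ (series v) (@cvg_addnl N) (u0 x)).
  have := @cvgB K K^o _ \oo _ _ _ _ _ sh (cvg_cst (series v N)).
  by rewrite sub0r => h; exact: h.
apply: (rnorm_cvg_le cv) => m.
apply: le_trans (_ : s (N + m)%N - s N <= _); last first.
  by rewrite lerB// nondecreasing_cvgn_le.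
rewrite /s !sub_series_geq ?leq_addr//.
apply: le_trans (_ : \sum_(N <= j < N + m) rnorm (v j) <= _).
  elim/big_rec2: _ => [|j a b _ ab]; first by rewrite rnorm0.
  by rewrite (le_trans (rnormD _ _))// lerD2l.
apply: ler_sum_nat => j _.
by rewrite rnorm_mlin (sup_norm_ub (mlin_bounded (u j)) x1).
Qed.

(** The sum of these terms is to be the value of the preimage of [T] at an operator represented by
    [(l, B, y)]. *)
Definition hn_pairing (T : clin X (dual F)) l B y : nat -> K^o :=
  fun j => l j * T (B j) (y j).

Lemma hn_pairing_le T l B y j : rnorm (hn_pairing T l B y j) <=
  rnorm T * (rnorm (l j : K^o) * rnorm (B j) * rnorm (y j)).
Proof.
rewrite (@rnormZ _ _ K^o) -mulrA mulrCA ler_wpM2l ?rnorm_ge0// mulrA.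
apply: le_trans (clin_le _ _) _.
by rewrite ler_wpM2r ?rnorm_ge0// clin_le.
Qed.

Lemma hn_pairing_series_le A T l B y N : hn_repr A l B y ->
  rnorm (series (hn_pairing T l B y) N) <= rnorm T * hn_cost l B y.
Proof.
move=> r; apply: le_trans (rnorm_series_le _ _) _.
apply: le_trans (ler_wpM2l (rnorm_ge0 _) (hn_cost_partial N r)).
by rewrite /series/= mulr_sumr ler_sum// => j _; exact: hn_pairing_le.
Qed.

Lemma hn_pairing_is_cvg A T l B y : hn_repr A l B y ->
  cvgn (series (hn_pairing T l B y)).
Proof.
move=> r; apply: cvg_abs_series.
pose c j := rnorm (l j : K^o) * rnorm (B j) * rnorm (y j).
apply: (@series_le_cvg _ _ (rnorm T *: c)) => [j|j|j|].
- exact: rnorm_ge0.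
- by rewrite !mulr_ge0 ?rnorm_ge0.
- exact: hn_pairing_le.
- by apply: is_cvg_seriesZ; exact: hn_cost_cvg r.
Qed.

Lemma hn_pairingD T l B y l' B' y' (v v' : K^o) :
  series (hn_pairing T l B y) @ \oo --> v ->
  series (hn_pairing T l' B' y') @ \oo --> v' ->
  series (hn_pairing T (interleave l l') (interleave B B') (interleave y y'))
    @ \oo --> v + v'.
Proof.
move=> cv cv'.
have -> : hn_pairing T (interleave l l') (interleave B B') (interleave y y') =
    interleave (hn_pairing T l B y) (hn_pairing T l' B' y').
  by apply/funext => j; rewrite /hn_pairing /interleave; case: ifP.
exact: cvg_interleave.
Qed.

Lemma hn_pairingZ T (a : K) l B y (v : K^o) :
  series (hn_pairing T l B y) @ \oo --> v ->
  series (hn_pairing T (fun j => a * l j) B y) @ \oo --> (a *: v : K^o).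
Proof.
move=> cv.
have -> : series (hn_pairing T (fun j => a * l j) B y) =
    (fun N => a *: series (hn_pairing T l B y) N).
  apply/funext => N; rewrite /series/= scaler_sumr; apply: eq_bigr => j _.
  by rewrite /hn_pairing /GRing.scale/= mulrA.
exact: cvgZl_tmp.
Qed.

Hypothesis ap : approximation_property X \/ approximation_property (dual F).

Lemma hn_repr0_pairing T l B y : hn_repr (0 : mlin E F) l B y ->
  series (hn_pairing T l B y) @ \oo --> (0 : K^o).
Proof.
move=> [cl BM yN lBy]; apply: nuclear_series_cvg0 => // g.
have [M BM'] := BM; have [N yN'] := yN.
apply: mlin_series_cvg0 => [|x].
  apply: (@series_le_cvg _ _
    ((rnorm g * N * M) *: (fun j => rnorm (l j : K^o)))).
  - by move=> j; exact: rnorm_ge0.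
  - move=> j; rewrite !mulr_ge0 ?rnorm_ge0//.
      exact: le_trans (rnorm_ge0 _) (yN' 0%N).
    exact: le_trans (rnorm_ge0 _) (BM' 0%N).
  - move=> j; rewrite rnormZ (@rnormZ _ _ K^o) /GRing.scale/=.
    rewrite [leRHS]mulrC mulrA ler_pM ?mulr_ge0 ?rnorm_ge0//.
    rewrite ler_wpM2l ?rnorm_ge0//; apply: le_trans (clin_le _ _) _.
    by rewrite ler_wpM2l ?rnorm_ge0.
  - exact: is_cvg_seriesZ.
(* At [x] the partial sums are the images under [g] of those representing the zero operator. *)
rewrite (_ : series _ = g \o series (fun j => (l j * B j x) *: y j)).
  rewrite -(clin0 g).
  by apply: continuous_cvg; [exact: clin_continuous|exact: lBy].
apply/funext => m; rewrite /= clin_series; congr (series _ m).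
apply/funext => j /=.
by rewrite clinZ /GRing.scale/= mulrAC.
Qed.

(** Interleaving the first representation with the negated second one represents [A - A = 0], so its
    pairing series converges both to [v - v'] and to [0]. *)
Lemma hn_pairing_unique T (A : mlin E F) l B y l' B' y' (v v' : K^o) :
  hn_repr A l B y -> hn_repr A l' B' y' ->
  series (hn_pairing T l B y) @ \oo --> v ->
  series (hn_pairing T l' B' y') @ \oo --> v' -> v = v'.
Proof.
move=> r r' cv cv'.
have [rB _] := hn_reprD r (hn_reprZ (-1) r').1.
rewrite scaleN1r subrr in rB.
have := hn_pairingD cv (hn_pairingZ (a := -1) cv').
rewrite scaleN1r => cB; apply/subr0_eq.
exact: (@norm_cvg_unique K K^o _ _ _ _ cB (hn_repr0_pairing T rB)).
Qed.

(** The limit along one representation of [A] serves all of them, so [phi] can be computed along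
    whichever representation is convenient; linearity and boundedness rest on this freedom. *)
Lemma hn_functional T : exists phi : hn -> K^o, forall (A : hn) l B y,
  hn_repr A l B y -> series (hn_pairing T l B y) @ \oo --> phi A.
Proof.
have h (A : hn) : exists v : K^o, forall l B y,
    hn_repr A l B y -> series (hn_pairing T l B y) @ \oo --> v.
  have /is_hnucP[l [B [y r]]] := hnuc_subproof A.
  have /cvg_ex[v cv] := hn_pairing_is_cvg (T := T) r.
  exists v => l' B' y' r'.
  have /cvg_ex[v' cv'] := hn_pairing_is_cvg (T := T) r'.
  by rewrite (hn_pairing_unique r r' cv cv').
have [phi phiP] := choice h.
by exists phi.
Qed.

Lemma hyper_borel_surj (T : clin X (dual F)) :
  exists phi : dual hn, hyper_borel phi = T.
Proof.
have [phi phiP] := hn_functional T.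
have lphi : linear phi.
  move=> a A A'.
  have /is_hnucP[l [B [y r]]] := hnuc_subproof A.
  have /is_hnucP[l' [B' [y' r']]] := hnuc_subproof A'.
  have [rZ _] := hn_reprZ a r; have [rD _] := hn_reprD rZ r'.
  have cD :=
    hn_pairingD (hn_pairingZ (a := a) (phiP _ _ _ _ r)) (phiP _ _ _ _ r').
  exact: (@norm_cvg_unique K K^o _ _ _ _ (phiP (a *: A + A') _ _ _ rD) cD).
have phi_clin : phi \in @is_clin R k hn K^o.
  apply/is_clinP; split => //; apply: rnorm_bounded_continuous => //.
  (* Each representation bounds [phi A] by [rnorm T] times its cost; a nearly optimal one leaves an
     excess of at most [e]. The [+ 1] keeps the divisor positive. *)
  exists (rnorm T) => A; rewrite rnorm_hnuc; apply/ler_addgt0Pr => e e0.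
  have T1 : 0 < rnorm T + 1 by rewrite ltr_wpDl// rnorm_ge0.
  have [|l [B [y [r re]]]] := @hn_norm_adherent _ _ _ _ _ A (e / (rnorm T + 1)).
    by rewrite divr_gt0.
  apply: le_trans (_ : rnorm T * hn_cost l B y <= _).
    apply: (rnorm_cvg_le (phiP _ _ _ _ r)) => N.
    exact: (hn_pairing_series_le T N r).
  apply: le_trans (ler_wpM2l (rnorm_ge0 _) (ltW re)) _.
  by rewrite mulrDr lerD2l mulrCA ler_piMr ?(ltW e0)// ler_pdivrMr//
    mul1r lerDl.
exists (CLin phi_clin); apply: clinP => A; apply: clinP => y.
(* A tensor has a one-term representation, along which the pairing series reduces to [T A y]. *)
have [r _] := hn_repr_tensor A y.
apply: (@norm_cvg_unique K K^o _ _ _ _ (phiP (hn_tensor A y) _ _ _ r)).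
by apply: cvg_series_single => [|j]; rewrite /hn_pairing /= ?mul1r ?mul0r.
Qed.

End hyper_borel_isomorphism.

(** * Isometry: peeling terms off a representation *)

Lemma series_recl (V : zmodType) (u : nat -> V) N :
  series u N.+1 = u 0%N + series (u \o S) N.
Proof. by rewrite /series/= big_nat_recl. Qed.

Lemma cvg_series_behead (K : numFieldType) (V : normedModType K)
    (u : nat -> V) (v : V) :
  series u @ \oo --> v -> series (u \o S) @ \oo --> v - u 0%N.
Proof.
move=> cu.
have -> : series (u \o S) = (fun N => series u N.+1 - u 0%N).
  by apply/funext => N; rewrite series_recl addrAC subrr add0r.
have cS : (fun N => series u N.+1) @ \oo --> v.
  under eq_fun do rewrite -addn1.
  exact: (cvg_comp _ (series u) (@cvg_addnr 1) cu).
by apply: cvgB => //; exact: cvg_cst.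
Qed.

Section hyper_borel_isometry.
Context {R : realType} {k : scalar_kind} {n : nat}.
Local Notation K := (scalars R k).
Variables (E : 'I_n -> normedModType K) (F : normedModType K).
Local Notation X := (mlin E K^o).
Local Notation hn := (hnuc E F).
Implicit Types (l : nat -> K) (B : nat -> X) (y : nat -> F).

Lemma hyper_borel_linear : linear (@hyper_borel R k n E F).
Proof. by move=> a phi psi; apply: clinP => A; apply: clinP. Qed.

Lemma hyper_borel_norm_le (phi : dual hn) :
  rnorm (hyper_borel phi) <= rnorm phi.
Proof.
rewrite rnorm_clin; apply: sup_norm_le; first exact: unit_ball_neq0.
move=> A A1.
rewrite rnorm_clin; apply: sup_norm_le; first exact: unit_ball_neq0.
move=> y y1; rewrite hyper_borelE; apply: le_trans (clin_le phi _) _.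
rewrite ler_piMr ?rnorm_ge0//; apply: le_trans (rnorm_hn_tensor _ _) _.
by rewrite mulr_ile1 ?rnorm_ge0.
Qed.

Definition hn_terms l B y : nat -> R :=
  fun j => rnorm (l j : K^o) * rnorm (B j) * rnorm (y j).

Lemma hn_repr_behead (A : hn) l B y : hn_repr A l B y ->
  hn_repr (A - l 0%N *: hn_tensor (B 0%N) (y 0%N) : hn)
    (l \o S) (B \o S) (y \o S).
Proof.
move=> [cl [M BM] [N yN] lBy]; split.
- have /cvg_ex[v cv] := cl; apply/cvg_ex.
  by exists (v - rnorm (l 0%N : K^o)); exact: (@cvg_series_behead R R _ _ cv).
- by exists M => j; exact: BM.
- by exists N => j; exact: yN.
move=> x; have := cvg_series_behead (lBy x); congr (_ --> _).
by rewrite -scalerA.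
Qed.

Lemma hn_cost_behead A l B y : hn_repr A l B y ->
  hn_cost l B y = hn_terms l B y 0%N + hn_cost (l \o S) (B \o S) (y \o S).
Proof.
move=> r; have cc : series (hn_terms l B y) @ \oo --> hn_cost l B y.
  exact: hn_cost_cvg r.
have -> : hn_cost (l \o S) (B \o S) (y \o S) =
    hn_cost l B y - hn_terms l B y 0%N.
  by apply: cvg_lim => //; exact: (@cvg_series_behead R R _ _ cc).
by rewrite subrKC.
Qed.

(** The first [N] terms are multiples of tensors, where the transform controls [phi]. The remainder
    is represented by the tail, so its hyper-nuclear norm is at most the remaining cost, and there
    [rnorm phi] is enough. *)
Lemma hyper_borel_bound (phi : dual hn) N (A : hn) l B y : hn_repr A l B y ->
  rnorm (phi A) <= rnorm (hyper_borel phi) * series (hn_terms l B y) N +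
    rnorm phi * (hn_cost l B y - series (hn_terms l B y) N).
Proof.
elim: N A l B y => [|N ih] A l B y r.
  rewrite /series/= big_geq// mulr0 add0r subr0.
  apply: le_trans (clin_le _ _) _; rewrite ler_wpM2l ?rnorm_ge0//.
  by rewrite rnorm_hnuc; exact: hn_norm_le.
have r' := hn_repr_behead r.
rewrite (hn_cost_behead r) series_recl opprD addrACA subrr add0r.
rewrite -(subrK (l 0%N *: hn_tensor (B 0%N) (y 0%N)) A) clinD.
rewrite (le_trans (rnormD _ _))// mulrDr -[leRHS]addrA [leRHS]addrC.
apply: lerD; first exact: ih r'.
rewrite clinZ (@rnormZ _ _ K^o) -hyper_borelE /hn_terms mulrCA -mulrA.
rewrite ler_wpM2l ?rnorm_ge0//.
apply: le_trans (clin_le _ _) _; rewrite mulrA ler_wpM2r ?rnorm_ge0//.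
by rewrite [leRHS]mulrC clin_le.
Qed.

Lemma hyper_borel_norm_ge (phi : dual hn) :
  rnorm phi <= rnorm (hyper_borel phi).
Proof.
rewrite [leLHS]rnorm_clin; apply: sup_norm_le; first exact: unit_ball_neq0.
move=> A; rewrite /unit_ball /= rnorm_hnuc => A1.
apply: le_trans (_ : rnorm (hyper_borel phi) * hn_norm A <= _); last first.
  by rewrite ler_piMr ?rnorm_ge0.
(* As [N] grows, the cost of the tail tends to [0], and with it the term carrying [rnorm phi]. *)
have cost_le l B y : hn_repr A l B y ->
    rnorm (phi A) <= rnorm (hyper_borel phi) * hn_cost l B y.
  move=> r; pose c := series (hn_terms l B y).
  have cc : c @ \oo --> hn_cost l B y by exact: hn_cost_cvg r.
  pose bd N :=
    rnorm (hyper_borel phi) * c N + rnorm phi * (hn_cost l B y - c N).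
  have cb : bd @ \oo --> rnorm (hyper_borel phi) * hn_cost l B y +
      rnorm phi * (hn_cost l B y - hn_cost l B y).
    by apply: cvgD; apply: cvgMr => //; apply: cvgB => //; exact: cvg_cst.
  rewrite subrr mulr0 addr0 in cb.
  apply: (ler_cvg_to (cvg_cst (rnorm (phi A))) cb).
  by apply: nearW => N; exact: hyper_borel_bound.
apply/ler_addgt0Pr => e e0.
have T1 : 0 < rnorm (hyper_borel phi) + 1 by rewrite ltr_wpDl// rnorm_ge0.
have [|l [B [y [r re]]]] :=
    @hn_norm_adherent _ _ _ _ _ A (e / (rnorm (hyper_borel phi) + 1)).
  by rewrite divr_gt0.
apply: le_trans (cost_le _ _ _ r) _.
apply: le_trans (ler_wpM2l (rnorm_ge0 _) (ltW re)) _.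
by rewrite mulrDr lerD2l mulrCA ler_piMr ?(ltW e0)// ler_pdivrMr//
    mul1r lerDl.
Qed.

End hyper_borel_isometry.

Theorem theorem3p4 (R : realType) (k : scalar_kind) (n : nat)
    (E : 'I_n -> completeNormedModType (scalars R k))
    (F : completeNormedModType (scalars R k)) :
  (0 < n)%N ->
  approximation_property (mlin E (scalars R k)^o)
    \/ approximation_property (dual F) ->
  isometric_isomorphism (@hyper_borel R k n E F).
Proof.
move=> _ ap; have lin := @hyper_borel_linear R k n E F.
have iso phi : `|@hyper_borel R k n E F phi| = `|phi|.
  rewrite -!rnormE; congr of_real; apply/eqP.
  by rewrite eq_le hyper_borel_norm_le hyper_borel_norm_ge.
have [g gK] := choice (hyper_borel_surj ap).
(* The right inverse [g] given by surjectivity is also a left inverse: the transform is linear,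
   preserves norms and sends [g (hyper_borel phi) - phi] to zero. *)
split => //; exists g => // phi; apply/subr0_eq/normr0_eq0.
by rewrite -iso -scaleN1r addrC lin gK scaleN1r addNr normr0.
Qed.
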